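(* Let $K$ be a field of characteristic $\ne2$, let $n\ge2$, let $\Lambda_n=\Lambda_n(K)$ be the Grassmann algebra and let $G=\mathrm{Aut}_K(\Lambda_n)$. Let $\mathcal N_1$ be the set of all normal elements $a$ of $\Lambda_n$ of the form $a=a_1+a_2+\cdots+a_n$ with $a_i\in\Lambda_{n,i}$ and $a_1\neq0$. Then: 1. $\mathcal N_1=Gx_1$ if $n$ is even. 2. $\mathcal N_1=Gx_1\cup G(x_1+x_2\cdots x_n)$ is the disjoint union of two orbits if $n$ is odd.
   Context: $\Lambda_n=\Lambda_n(K)=K\lfloor x_1,\ldots,x_n\rfloor$ is the $K$-algebra with generators $x_1,\ldots,x_n$ and defining relations $x_i^2=0$, $x_ix_j=-x_jx_i$ ($i\ne j$). It is $\mathbb N$-graded, $\Lambda_n=\bigoplus_{i=0}^n\Lambda_{n,i}$, where $\Lambda_{n,i}$ is spanned over $K$ by the products of $i$ distinct generators. $G=\mathrm{Aut}_K(\Lambda_n)$ is the group of $K$-algebra automorphisms, and $Gy$ denotes the $G$-orbit of $y$. An element $r$ of a ring $R$ is normal if $rR=Rr$. *)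

(* Defs.v *)
From HB Require Import structures.
From mathcomp Require Import all_boot all_order all_algebra.

Set Implicit Arguments.
Unset Strict Implicit.
Unset Printing Implicit Defensive.

Import GRing.Theory.
Local Open Scope ring_scope.

Definition grassmann_rel (K : fieldType) (n : nat) (B : algType K)
    (y : 'I_n -> B) : Prop :=
  (forall i, y i * y i = 0) /\
  (forall i j, i != j -> y i * y j = - (y j * y i)).

(* (L, x) is the K-algebra with generators x_1, ..., x_n (here x 0, ...,
   x (n-1)) and defining relations x_i^2 = 0, x_i x_j = - x_j x_i: it satisfies
   the relations and is initial among the K-algebras with n elements that do.
   A pair (L, x) as below is therefore unique up to a unique isomorphism, and
   [ext_grassmann] gives one. *)
Definition is_grassmann (K : fieldType) (n : nat) (L : algType K)
    (x : 'I_n -> L) : Prop :=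
  grassmann_rel x /\
  forall (B : algType K) (y : 'I_n -> B), grassmann_rel y ->
    exists f : {lrmorphism L -> B},
      (forall i, f (x i) = y i) /\
      forall g : {lrmorphism L -> B}, (forall i, g (x i) = y i) -> g =1 f.

(* Lambda_{n,d}: the K-span of the products of d distinct generators. *)
Definition homog (K : fieldType) (n : nat) (L : algType K)
    (x : 'I_n -> L) (d : nat) (a : L) : Prop :=
  exists c : d.-tuple 'I_n -> K,
    a = \sum_(s : d.-tuple 'I_n | uniq s) c s *: \prod_(i <- s) x i.

(* r R = R r *)
Definition normal_elt (R : nzRingType) (r : R) : Prop :=
  forall z : R, (exists b, z = r * b) <-> (exists b, z = b * r).

(* z lies in the orbit G y, G = Aut_K(L). *)
Definition aut_orbit (K : fieldType) (L : algType K) (y z : L) : Prop :=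
  exists f : {lrmorphism L -> L}, bijective f /\ z = f y.

Definition N1 (K : fieldType) (n : nat) (L : algType K)
    (x : 'I_n -> L) (a : L) : Prop :=
  normal_elt a /\
  exists a_ : nat -> L,
    [/\ forall i, (1 <= i <= n)%N -> homog x i (a_ i),
        a_ 1%N != 0
      & a = \sum_(1 <= i < n.+1) a_ i].

(* A model of the Grassmann algebra: a : {ffun {set 'I_n} -> K} stands for
   \sum_S a S *: x_S, where x_S is the increasing product of the x_i, i in S.
   One has x_A x_B = gsign A B *: x_(A :|: B), where gsign A B is 0 if A and B
   meet, and otherwise the sign of the shuffle sorting A followed by B. *)
Section Model.

Variables (K : fieldType) (n : nat).
Implicit Types (A B C S : {set 'I_n}).

Definition gtwist (i j : 'I_n) : K :=
  if i == j then 0 else if (i < j)%N then 1 else -1.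

Definition gsign A B : K := \prod_(i in A) \prod_(j in B) gtwist i j.

Definition ext : Type := {ffun {set 'I_n} -> K}.
HB.instance Definition _ :=
  GRing.Lmodule.copy ext {ffun {set 'I_n} -> K^o}.

Definition ext_basis S : ext := [ffun T => (T == S)%:R].

Definition ext_mul (a b : ext) : ext :=
  \sum_A \sum_B (a A * b B * gsign A B) *: ext_basis (A :|: B).

Lemma gsign0l B : gsign set0 B = 1.
Proof. by rewrite /gsign big_set0. Qed.

Lemma gsign0r A : gsign A set0 = 1.
Proof. by rewrite /gsign big1 // => i _; rewrite big_set0. Qed.

Lemma gsign_meet A B : ~~ [disjoint A & B] -> gsign A B = 0.
Proof.
rewrite -setI_eq0 => /set0Pn[i /setIP[iA iB]].
by rewrite /gsign (bigD1 i) //= (bigD1 i) //= /gtwist eqxx !mul0r.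
Qed.

Lemma prod_setU A B (F : 'I_n -> K) : [disjoint A & B] ->
  \prod_(i in A :|: B) F i = (\prod_(i in A) F i) * \prod_(i in B) F i.
Proof.
by move=> dAB; rewrite -bigU //; apply: eq_bigl => i; rewrite !inE.
Qed.

Lemma gsignUl A B C :
  [disjoint A & B] -> gsign (A :|: B) C = gsign A C * gsign B C.
Proof. by move=> dAB; rewrite /gsign prod_setU. Qed.

Lemma gsignUr A B C :
  [disjoint B & C] -> gsign A (B :|: C) = gsign A B * gsign A C.
Proof.
move=> dBC; rewrite /gsign -big_split /=; apply: eq_bigr => i _.
by rewrite prod_setU.
Qed.

Lemma gsignA A B C :
  gsign A B * gsign (A :|: B) C = gsign B C * gsign A (B :|: C).
Proof.
have [dAB|ndAB] := boolP [disjoint A & B]; last first.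
  rewrite (gsign_meet ndAB) mul0r (@gsign_meet A) ?mulr0 //.
  by apply: contra ndAB; apply: disjointWr; apply: subsetUl.
have [dBC|ndBC] := boolP [disjoint B & C]; last first.
  rewrite (gsign_meet ndBC) mul0r (@gsign_meet (A :|: B)) ?mulr0 //.
  by apply: contra ndBC; apply: disjointWl; apply: subsetUr.
by rewrite gsignUl // gsignUr // mulrA mulrC.
Qed.

Lemma ext_sum (a : ext) : a = \sum_S a S *: ext_basis S.
Proof.
apply/ffunP => T; rewrite sum_ffunE (bigD1 T) //= big1 => [|S neST].
  by rewrite addr0 !ffunE eqxx /GRing.scale /= mulr1.
by rewrite !ffunE eq_sym (negPf neST) /GRing.scale /= mulr0.
Qed.

Fact ext_mulDl : left_distributive ext_mul +%R.
Proof.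
move=> a b c; rewrite /ext_mul -big_split; apply: eq_bigr => A _ /=.
rewrite -big_split; apply: eq_bigr => B _ /=.
by rewrite ffunE !mulrDl scalerDl.
Qed.

Fact ext_mulDr : right_distributive ext_mul +%R.
Proof.
move=> a b c; rewrite /ext_mul -big_split; apply: eq_bigr => A _ /=.
rewrite -big_split; apply: eq_bigr => B _ /=.
by rewrite ffunE mulrDr mulrDl scalerDl.
Qed.

Fact ext_mulZl k a b : ext_mul (k *: a) b = k *: ext_mul a b.
Proof.
rewrite /ext_mul scaler_sumr; apply: eq_bigr => A _.
rewrite scaler_sumr; apply: eq_bigr => B _.
by rewrite scalerA !ffunE /GRing.scale /= !mulrA.
Qed.

Fact ext_mulZr k a b : ext_mul a (k *: b) = k *: ext_mul a b.
Proof.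
rewrite /ext_mul scaler_sumr; apply: eq_bigr => A _.
rewrite scaler_sumr; apply: eq_bigr => B _.
rewrite scalerA !ffunE; congr (_ *: _).
by rewrite !mulrA [a A * _]mulrC.
Qed.

Fact ext_mul0l b : ext_mul 0 b = 0.
Proof. by have := ext_mulZl 0 0 b; rewrite !scale0r. Qed.

Fact ext_mul0r b : ext_mul b 0 = 0.
Proof. by have := ext_mulZr 0 b 0; rewrite !scale0r. Qed.

Lemma ext_mul_suml (F : {set 'I_n} -> ext) b :
  ext_mul (\sum_S F S) b = \sum_S ext_mul (F S) b.
Proof.
exact: (big_morph (ext_mul^~ b) (fun a c => ext_mulDl a c b) (ext_mul0l b)).
Qed.

Lemma ext_mul_sumr b (F : {set 'I_n} -> ext) :
  ext_mul b (\sum_S F S) = \sum_S ext_mul b (F S).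
Proof. exact: (big_morph (ext_mul b) (ext_mulDr b) (ext_mul0r b)). Qed.

Lemma ext_mul_basis A B :
  ext_mul (ext_basis A) (ext_basis B) = gsign A B *: ext_basis (A :|: B).
Proof.
rewrite /ext_mul (bigD1 A) //= [X in _ + X]big1 ?addr0 => [|A' neA]; last first.
  by rewrite big1 // => B' _; rewrite ffunE (negPf neA) !mul0r scale0r.
rewrite (bigD1 B) //= big1 ?addr0 => [|B' neB]; last first.
  by rewrite [ext_basis B B']ffunE (negPf neB) mulr0 mul0r scale0r.
by rewrite !ffunE !eqxx !mul1r.
Qed.

Fact ext_mulA : associative ext_mul.
Proof.
move=> a b c.
rewrite (ext_sum a) ext_mul_suml [ext_mul (\sum_S _) b]ext_mul_suml.
rewrite [RHS]ext_mul_suml; apply: eq_bigr => A _.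
rewrite !ext_mulZl; congr (_ *: _).
rewrite (ext_sum b) [ext_mul (\sum_S _) c]ext_mul_suml [LHS]ext_mul_sumr.
rewrite [ext_mul (ext_basis A) (\sum_S _)]ext_mul_sumr [RHS]ext_mul_suml.
apply: eq_bigr => B _; rewrite !(ext_mulZl, ext_mulZr); congr (_ *: _).
rewrite (ext_sum c) [ext_mul (ext_basis B) _]ext_mul_sumr.
rewrite [LHS]ext_mul_sumr [RHS]ext_mul_sumr; apply: eq_bigr => C _.
rewrite !ext_mulZr; congr (_ *: _).
rewrite !ext_mul_basis ext_mulZl ext_mulZr !ext_mul_basis !scalerA.
by rewrite gsignA setUA.
Qed.

Fact ext_mul1l : left_id (ext_basis set0) ext_mul.
Proof.
move=> a; rewrite [in LHS](ext_sum a) ext_mul_sumr [RHS]ext_sum.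
apply: eq_bigr => S _.
by rewrite ext_mulZr ext_mul_basis gsign0l scale1r set0U.
Qed.

Fact ext_mul1r : right_id (ext_basis set0) ext_mul.
Proof.
move=> a; rewrite [in LHS](ext_sum a) ext_mul_suml [RHS]ext_sum.
apply: eq_bigr => S _.
by rewrite ext_mulZl ext_mul_basis gsign0r scale1r setU0.
Qed.

Fact ext_oner_neq0 : ext_basis set0 != 0.
Proof.
apply/eqP => /ffunP/(_ set0); rewrite !ffunE eqxx => /eqP.
by rewrite oner_eq0.
Qed.

HB.instance Definition _ := GRing.Zmodule_isNzRing.Build ext
  ext_mulA ext_mul1l ext_mul1r ext_mulDl ext_mulDr ext_oner_neq0.
HB.instance Definition _ := GRing.Lmodule_isLalgebra.Build K ext
  (fun k a b => esym (ext_mulZl k a b)).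
HB.instance Definition _ := GRing.Lalgebra_isAlgebra.Build K ext
  (fun k a b => esym (ext_mulZr k a b)).

Definition ext_gen (i : 'I_n) : ext := ext_basis [set i].

Lemma ext_basisM A B :
  ext_basis A * ext_basis B = gsign A B *: ext_basis (A :|: B).
Proof. exact: ext_mul_basis. Qed.

Lemma ext_grassmann_rel : grassmann_rel ext_gen.
Proof.
split=> [i|i j neij]; rewrite /ext_gen !ext_basisM /gsign !big_set1 /gtwist.
  by rewrite eqxx scale0r.
rewrite (negPf neij) eq_sym (negPf neij) setUC.
have [ltij|ltji|/val_inj eqij] := ltngtP i j; last by rewrite eqij eqxx in neij.
- by rewrite scale1r scaleN1r opprK.
- by rewrite scale1r scaleN1r.
Qed.

Let lto (i j : 'I_n) := (i < j)%N.

Let lto_enum : sorted lto (index_enum 'I_n).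
Proof.
have: sorted ltn (map val (index_enum 'I_n)).
  have -> : index_enum 'I_n = enum 'I_n by rewrite [LHS]unlock enumT.
  by rewrite val_enum_ord iota_ltn_sorted.
by rewrite sorted_map.
Qed.

Let path_lto i r : path lto i r = all (lto i) r && sorted lto r.
Proof. by rewrite path_sortedE // => a b c; apply: ltn_trans. Qed.

Lemma gtwist_lt i j : lto i j -> gtwist i j = 1.
Proof. by rewrite /gtwist /lto => ltij; rewrite ltij -val_eqE /= ltn_eqF. Qed.

Lemma gsign_head h r A : path lto h r ->
  gsign [set h] [set i in r | i \in A] = 1.
Proof.
rewrite path_lto => /andP[/allP hr _].
rewrite /gsign big_set1 big1 // => j; rewrite inE => /andP[/hr ltij _].
exact: gtwist_lt.
Qed.

Lemma set_cons_in h r A : h \in A ->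
  [set i in h :: r | i \in A] = h |: [set i in r | i \in A].
Proof.
by move=> hA; apply/setP => i; rewrite !inE; case: eqVneq => // ->; rewrite hA.
Qed.

Lemma set_cons_notin h r A : h \notin A ->
  [set i in h :: r | i \in A] = [set i in r | i \in A].
Proof.
move=> hA; apply/setP => i; rewrite !inE; case: eqVneq => // ->.
by rewrite (negPf hA) !andbF.
Qed.

Lemma set_index_enum A : [set i in index_enum 'I_n | i \in A] = A.
Proof. by apply/setP => i; rewrite !inE mem_index_enum. Qed.

Lemma ext_basis_prod A : ext_basis A = \prod_(i in A) ext_gen i.
Proof.
rewrite -{1}(set_index_enum A).
elim: (index_enum _) lto_enum => [_|h r IHr /= rS].
  by rewrite big_nil; congr ext_basis; apply/setP => i; rewrite !inE.
have rS' : sorted lto r by move: rS; rewrite path_lto => /andP[].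
rewrite big_cons; case: ifPn => hA; last by rewrite set_cons_notin ?IHr.
by rewrite -IHr // ext_basisM gsign_head // scale1r set_cons_in.
Qed.

Section Universal.

Variables (L : algType K) (y : 'I_n -> L).
Hypothesis y_rel : grassmann_rel y.

Lemma gen_mul_prod r i B : sorted lto r -> i \in r ->
  y i * \prod_(j <- r | j \in B) y j =
  (\prod_(j <- r | j \in B) gtwist i j)
    *: \prod_(j <- r | j \in i |: B) y j.
Proof.
have [ysq yanti] := y_rel.
elim: r => //= h r IHr; rewrite path_lto inE => /andP[/allP hr rS].
have [eih _|neih /= ir] := eqVneq i h.
  rewrite -{h}eih in hr *.
  have eqr : \prod_(j <- r | j \in i |: B) y j = \prod_(j <- r | j \in B) y j.
    rewrite big_seq_cond [RHS]big_seq_cond; apply: eq_bigl => j; rewrite !inE.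
    have [->|//] := eqVneq j i.
    by have [/hr|//] := boolP (i \in r); rewrite /lto ltnn.
  rewrite !big_cons setU11 eqr; case: ifP => iB.
    by rewrite mulrA ysq mul0r /gtwist eqxx mul0r scale0r.
  rewrite [X in X *: _]big_seq_cond [X in X *: _]big1 ?scale1r //.
  move=> j /andP[/hr ltij _].
  exact: gtwist_lt.
rewrite !big_cons !inE eq_sym (negPf neih) /=; case: ifP => hB; last exact: IHr.
have /negbTE ltihF : ~~ (i < h)%N by rewrite -leqNgt ltnW //; apply: hr.
rewrite mulrA yanti // -mulNr -mulrA -scalerA mulNr -mulrN.
rewrite IHr // scalerAr /gtwist (negPf neih) ltihF.
by rewrite scaleN1r -scalerAr mulrN scalerAr.
Qed.

Let ymon S := \prod_(i in S) y i.

Lemma gen_mul_mon i B : y i * ymon B = gsign [set i] B *: ymon (i |: B).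
Proof.
by rewrite /ymon /gsign big_set1; apply: gen_mul_prod; rewrite ?mem_index_enum.
Qed.

Lemma prod_mul_mon r A B : sorted lto r ->
  (\prod_(i <- r | i \in A) y i) * ymon B =
  gsign [set i in r | i \in A] B *: ymon ([set i in r | i \in A] :|: B).
Proof.
elim: r => [|h r IHr] /=.
  move=> _; rewrite big_nil mul1r.
  have ->: [set i in [::] | i \in A] = set0 by apply/setP => i; rewrite !inE.
  by rewrite gsign0l scale1r set0U.
move=> hr; have rS : sorted lto r by move: hr; rewrite path_lto => /andP[].
rewrite big_cons; case: ifPn => hA; last by rewrite IHr // set_cons_notin.
rewrite -mulrA IHr // -scalerAr gen_mul_mon scalerA set_cons_in //.
by rewrite setUA -gsignA gsign_head // mul1r.
Qed.

Lemma mon_mul A B : ymon A * ymon B = gsign A B *: ymon (A :|: B).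
Proof.
by rewrite {1}/ymon prod_mul_mon // set_index_enum.
Qed.

Definition ext_lift of grassmann_rel y := fun a : ext => \sum_S a S *: ymon S.

Local Notation phi := (ext_lift y_rel).

Fact ext_lift_linear : linear phi.
Proof.
move=> k a b; rewrite /ext_lift scaler_sumr -big_split /=.
by apply: eq_bigr => S _; rewrite !ffunE scalerDl scalerA.
Qed.
HB.instance Definition _ :=
  GRing.isLinear.Build K ext L _ phi ext_lift_linear.

Lemma ext_lift_basis S : phi (ext_basis S) = ymon S.
Proof.
rewrite /ext_lift (bigD1 S) //= big1 => [|T neT].
  by rewrite addr0 ffunE eqxx scale1r.
by rewrite ffunE (negPf neT) scale0r.
Qed.

Fact ext_lift_monoid : monoid_morphism phi.
Proof.
split=> [|a b]; first by rewrite ext_lift_basis /ymon big_set0.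
rewrite {1}(ext_sum a) mulr_suml linear_sum {2}/ext_lift mulr_suml.
apply: eq_bigr => A _; rewrite -!scalerAl linearZ; congr (_ *: _).
rewrite {1}(ext_sum b) mulr_sumr linear_sum /ext_lift mulr_sumr.
apply: eq_bigr => B _; rewrite -!scalerAr.
rewrite -/(phi _) linearZ ext_basisM linearZ /= ext_lift_basis.
by rewrite mon_mul.
Qed.
HB.instance Definition _ :=
  GRing.isMonoidMorphism.Build ext L phi ext_lift_monoid.

Lemma ext_lift_gen i : phi (ext_gen i) = y i.
Proof. by rewrite ext_lift_basis /ymon big_set1. Qed.

End Universal.

Theorem ext_grassmann : is_grassmann ext_gen.
Proof.
split=> [|B y y_rel]; first exact: ext_grassmann_rel.
exists (ext_lift y_rel); split=> [i|g gE a]; first exact: ext_lift_gen.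
rewrite (ext_sum a) !linear_sum; apply: eq_bigr => S _.
rewrite !linearZ /= ext_lift_basis ext_basis_prod rmorph_prod.
by congr (_ *: _); apply: eq_bigr => i _; apply: gE.
Qed.

End Model.

(* Main.v *)
(* Odd elements anticommute and even elements are central.  Let [a] be normal
   with nonzero linear part; after a swap of generators, [x_1] occurs in it.
   Sending [x_1] to the odd part of [a] is an automorphism, so one may assume
   [a = x_1 + e] with [e] even of order at least 2.  Writing [e = x_1 p + q]
   with [q] free of [x_1], conjugation by the unit [1 - p / 2] turns [x_1 + q]
   into [a].  Normality of [x_1 + q] gives [x_i (x_1 + q) = (x_1 + q) b], hence
   [2 x_1 x_i q = q ^ 2 (x_i - b)]; comparing lowest degrees forces [q] to be a
   multiple of [x_2 ... x_n], and [q] can only be nonzero when [n] is odd.  A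
   rescaling of [x_2] then normalizes the coefficient.  The two orbits differ
   because [x_1] squares to 0 and [x_1 + x_2 ... x_n] does not. *)

From HB Require Import structures.
Require Import Defs.
From mathcomp Require Import all_boot all_order all_algebra.
From mathcomp Require Import perm zify.

Set Implicit Arguments.
Unset Strict Implicit.
Unset Printing Implicit Defensive.

Import GRing.Theory.
Local Open Scope ring_scope.

(** * Preliminaries: transport of normality, and injective endomorphisms in finite dimension *)

Lemma normal_bij (R R' : nzRingType) (f : {rmorphism R -> R'}) (a : R) :
  bijective f -> normal_elt a <-> normal_elt (f a).
Proof.
move=> [g fK gK]; split=> na z.
- split=> [[b zE]|[b zE]].
    have /na[b' b'E] : exists b, g z = a * b.
      by exists (g b); apply: (can_inj fK); rewrite rmorphM !gK.
    by exists (f b'); rewrite -rmorphM -b'E gK.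
  have /na[b' b'E] : exists b, g z = b * a.
    by exists (g b); apply: (can_inj fK); rewrite rmorphM !gK.
  by exists (f b'); rewrite -rmorphM -b'E gK.
- split=> [[b zE]|[b zE]].
    have /na[b' b'E] : exists b, f z = f a * b.
      by exists (f b); rewrite zE rmorphM.
    by exists (g b'); apply: (can_inj fK); rewrite rmorphM gK.
  have /na[b' b'E] : exists b, f z = b * f a.
    by exists (f b); rewrite zE rmorphM.
  by exists (g b'); apply: (can_inj fK); rewrite rmorphM gK.
Qed.

Lemma linear_inj_bij (K : fieldType) (V : vectType K) (f : {linear V -> V}) :
  injective f -> bijective f.
Proof.
move=> injf; have kf : lker (linfun f) == 0%VS.
  by apply/lker0P => u v; rewrite !lfunE /=; apply: injf.
exists ((linfun f)^-1)%VF => v.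
  by have := lker0_lfunK kf v; rewrite lfunE.
by have := lker0_lfunVK kf v; rewrite lfunE.
Qed.

(* [big_enum] is only available for commutative operators. *)
Lemma prod_enum (R : pzRingType) (I : finType) (A : {set I}) (y : I -> R) :
  \prod_(i <- enum A) y i = \prod_(i in A) y i.
Proof. by rewrite -[RHS]big_filter [index_enum _]unlock. Qed.

(** * Inner automorphisms *)

Section Conjugation.

Variables (K : fieldType) (A : algType K) (u v : A).
Hypotheses (uvK : u * v = 1) (vuK : v * u = 1).

(** The two inverse relations are arguments so that the algebra morphism structure can be attached
    to the function itself. *)
Definition conj_by of u * v = 1 & v * u = 1 := fun z : A => u * z * v.

Local Notation phi := (conj_by uvK vuK).

Fact conj_by_linear : linear phi.
Proof. by move=> k a b; rewrite /conj_by mulrDr mulrDl -scalerAr -scalerAl. Qed.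
HB.instance Definition _ :=
  GRing.isLinear.Build K A A _ phi conj_by_linear.

Fact conj_by_monoid : monoid_morphism phi.
Proof.
split=> [|a b]; rewrite /conj_by ?mulr1 // !mulrA.
by rewrite -[in RHS](mulrA (u * a)) vuK mulr1.
Qed.
HB.instance Definition _ :=
  GRing.isMonoidMorphism.Build A A phi conj_by_monoid.

Lemma conj_by_bij : bijective phi.
Proof.
by exists (fun z => v * z * u) => z; rewrite /conj_by !mulrA ?uvK ?vuK mul1r
  -mulrA ?uvK ?vuK mulr1.
Qed.

End Conjugation.

(** * Degrees and coefficients of products in the model *)

Section Exterior.

Variables (K : fieldType) (n : nat).
Implicit Types (A B S T : {set 'I_n}) (P Q : pred nat).

Local Notation E := (ext K n).
Local Notation e_ := (@ext_basis K n).
Local Notation X := (@ext_gen K n).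

(** With [pred1 d] this is homogeneity of degree [d], with [leq d] it is the [d]-th power of the
    augmentation ideal, and with a parity test it gives the even or the odd elements. *)
Definition supp P (a : E) : Prop := forall S, a S != 0 -> P #|S|.

Lemma supp0 P : supp P 0.
Proof. by move=> S; rewrite ffunE eqxx. Qed.

Lemma suppD P (a b : E) : supp P a -> supp P b -> supp P (a + b).
Proof.
move=> Pa Pb S; rewrite ffunE; have [->|/Pa //] := eqVneq (a S) 0.
by rewrite add0r; apply: Pb.
Qed.

Lemma suppZ P k (a : E) : supp P a -> supp P (k *: a).
Proof.
by move=> Pa S; rewrite ffunE /GRing.scale /= mulf_eq0 => /norP[_ /Pa].
Qed.

Lemma suppN P (a : E) : supp P a -> supp P (- a).
Proof. by move=> Pa; rewrite -scaleN1r; apply: suppZ. Qed.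

Lemma supp_sum P I (r : seq I) (C : pred I) (F : I -> E) :
  (forall i, C i -> supp P (F i)) -> supp P (\sum_(i <- r | C i) F i).
Proof. by move=> PF; elim/big_ind: _ => //; [apply: supp0|apply: suppD]. Qed.

Lemma supp_basis P S : P #|S| -> supp P (e_ S).
Proof. by move=> PS T; rewrite ffunE; case: (eqVneq T S) => [-> //|_]; rewrite eqxx. Qed.

Lemma supp_sub P Q (a : E) : (forall d, P d -> Q d) -> supp P a -> supp Q a.
Proof. by move=> PQ Pa S /Pa /PQ. Qed.

Lemma coefZ k (a : E) S : (k *: a) S = k * a S.
Proof. by rewrite ffunE. Qed.

Lemma coefM (a b : E) S :
  (a * b) S = \sum_A \sum_B a A * b B * gsign K A B * (S == A :|: B)%:R.
Proof.
rewrite {1}/GRing.mul /= /ext_mul sum_ffunE; apply: eq_bigr => A _.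
by rewrite sum_ffunE; apply: eq_bigr => B _; rewrite coefZ ffunE.
Qed.

Lemma gsign_neq0 A B : (gsign K A B != 0) = [disjoint A & B].
Proof.
have [dAB|/gsign_meet ->] := boolP [disjoint A & B]; last by rewrite eqxx.
apply/prodf_neq0 => i iA; apply/prodf_neq0 => j jB.
rewrite /gtwist; case: (eqVneq i j) => [eij|_].
  by move: dAB => /disjointFr/(_ iA); rewrite eij jB.
by case: ifP; rewrite ?oppr_eq0 oner_eq0.
Qed.

Lemma coefM_neq0 (a b : E) S : (a * b) S != 0 ->
  exists A B, [/\ a A != 0, b B != 0, [disjoint A & B] & S = A :|: B].
Proof.
rewrite coefM; case: (pickP (fun AB : {set 'I_n} * {set 'I_n} =>
  a AB.1 * b AB.2 * gsign K AB.1 AB.2 * (S == AB.1 :|: AB.2)%:R != 0)) => /=.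
  move=> [A B] /=; rewrite !mulf_eq0 !negb_or -!andbA gsign_neq0.
  case/and4P=> aA bB dAB; case: (eqVneq S (A :|: B)); last by rewrite eqxx.
  by move=> SE _ _; exists A, B.
move=> z; rewrite big1 ?eqxx // => A _; rewrite big1 // => B _.
by have /negbFE/eqP := z (A, B).
Qed.

Lemma suppM P Q (R : pred nat) (a b : E) :
  (forall i j, P i -> Q j -> R (i + j)%N) ->
  supp P a -> supp Q b -> supp R (a * b).
Proof.
move=> PQR Pa Qb S /coefM_neq0[A [B [/Pa PA /Qb QB dAB ->]]].
by rewrite cardsU disjoint_setI0 // cards0 subn0; apply: PQR.
Qed.

(** Among the [B] with [A :|: B = T], only [T :\: A] is disjoint from [A]; the sign [gsign] vanishes
    on all others. *)
Lemma coefM_basisl A (b : E) T :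
  (e_ A * b) T = if A \subset T then gsign K A (T :\: A) * b (T :\: A) else 0.
Proof.
rewrite coefM (bigD1 A) //= [X in _ + X]big1 ?addr0; last first.
  by move=> A' neA; rewrite big1 // => B _; rewrite ffunE (negPf neA) !mul0r.
rewrite ffunE eqxx; case: ifPn => [sAT|nsAT]; last first.
  rewrite big1 // => B _; case: eqVneq => [TE|]; last by rewrite mulr0.
  by rewrite TE subsetUl in nsAT.
rewrite (bigD1 (T :\: A)) //= big1 ?addr0.
  have -> : A :|: T :\: A = T by rewrite -{1}(setIidPr sAT) setID.
  by rewrite eqxx mul1r mulr1 mulrC.
move=> B neB; case: eqVneq => [TE|]; last by rewrite mulr0.
rewrite (gsign_meet K) ?mulr0 ?mul0r //; apply: contraNN neB => dAB.
rewrite TE setDUl setDv set0U; apply/eqP/esym/setDidPl.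
by rewrite disjoint_sym.
Qed.

(** * Parity and supercommutativity *)

Lemma gsignC A B : gsign K A B = (-1) ^+ (#|A| * #|B|) * gsign K B A.
Proof.
rewrite /gsign [in RHS]exchange_big /=.
have -> : (-1) ^+ (#|A| * #|B|) = \prod_(i in A) \prod_(j in B) (-1 : K).
  by rewrite !prodr_const -exprM mulnC.
rewrite -big_split; apply: eq_bigr => i _; rewrite -big_split.
apply: eq_bigr => j _ /=; rewrite /gtwist eq_sym.
case: eqVneq => [_|neij]; first by rewrite mulr0.
by case: ltngtP => [||/val_inj ij]; rewrite ?mulN1r ?opprK // ij eqxx in neij *.
Qed.

Lemma basisC A B : e_ A * e_ B = (-1) ^+ (#|A| * #|B|) *: (e_ B * e_ A).
Proof. by rewrite !ext_basisM gsignC scalerA setUC. Qed.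

Local Notation par c := (supp (fun d => odd d == c)).

Lemma parC b c (u v : E) : par b u -> par c v ->
  u * v = (-1) ^+ (b && c) *: (v * u).
Proof.
move=> pu pv; rewrite (ext_sum u) mulr_suml mulr_sumr scaler_sumr.
apply: eq_bigr => A _; rewrite -scalerAl -scalerAr scalerA mulrC -scalerA.
have [->|/pu/eqP pA] := eqVneq (u A) 0; first by rewrite !scale0r.
congr (_ *: _); rewrite (ext_sum v) mulr_suml mulr_sumr scaler_sumr.
apply: eq_bigr => B _; rewrite -scalerAl -scalerAr scalerA mulrC -scalerA.
have [->|/pv/eqP pB] := eqVneq (v B) 0; first by rewrite !scale0r.
by rewrite basisC -signr_odd oddM pA pB.
Qed.

Definition part (c : bool) (a : E) : E :=
  [ffun S : {set 'I_n} => if odd #|S| == c then a S else 0].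

Lemma par_part c a : par c (part c a).
Proof. by move=> S; rewrite ffunE; case: ifP => //; rewrite eqxx. Qed.

Lemma part_sum a : a = part true a + part false a.
Proof.
by apply/ffunP => S; rewrite !ffunE; case: odd; rewrite ?addr0 ?add0r.
Qed.

Lemma even_comm (u v : E) : par false u -> u * v = v * u.
Proof.
move=> pu; rewrite (part_sum v) mulrDl mulrDr.
by rewrite !(parC (b := false) pu (@par_part _ _)) !scale1r.
Qed.

Lemma odd_anticomm (u v : E) : par true u -> par true v -> u * v = - (v * u).
Proof. by move=> pu pv; rewrite (parC pu pv) scaleN1r. Qed.

Lemma par_gen i : par true (X i).
Proof. by apply: supp_basis; rewrite cards1. Qed.

(** * Consequences of characteristic different from 2 *)

Hypothesis two_neq0 : 2%:R != 0 :> K.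

Lemma self_opp0 (u : E) : u = - u -> u = 0.
Proof.
move=> /eqP; rewrite -addr_eq0 -mulr2n -scaler_nat scaler_eq0 (negPf two_neq0).
by move/eqP.
Qed.

Lemma odd_sq0 (u : E) : par true u -> u * u = 0.
Proof. by move=> pu; apply/self_opp0/odd_anticomm. Qed.

(** By universality, the images of the generators may thus be any odd elements; [elem_aut] and
    [swap_aut] are built this way. *)
Lemma odd_rel (y : 'I_n -> E) : (forall i, par true (y i)) -> grassmann_rel y.
Proof.
by move=> py; split=> [i|i j _]; [apply: odd_sq0|apply: odd_anticomm].
Qed.


(** * Effect of endomorphisms on degrees *)

Lemma lrm_basis (L : algType K) (f : {lrmorphism E -> L}) S :
  f (e_ S) = \prod_(i in S) f (X i).
Proof. by rewrite ext_basis_prod rmorph_prod. Qed.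

Lemma eq_lrm (L : algType K) (f g : {lrmorphism E -> L}) :
  (forall i, f (X i) = g (X i)) -> f =1 g.
Proof.
move=> fg a; rewrite (ext_sum a) !linear_sum; apply: eq_bigr => S _.
by rewrite !linearZ /= !lrm_basis; congr (_ *: _); apply: eq_bigr.
Qed.

Lemma coef_gen i j : X i [set j] = (j == i)%:R.
Proof. by rewrite ffunE (inj_eq set1_inj). Qed.

(** [F m] describes the degrees allowed in a product of [m] factors. It is used with degree equal to
    [m], degree at least [m], and degree of the parity of [m]. *)
Lemma supp_prod (F : nat -> pred nat) r (y : 'I_n -> E) :
  F 0 0 -> (forall m i j, F 1 i -> F m j -> F m.+1 (i + j)%N) ->
  (forall i, supp (F 1) (y i)) -> supp (F (size r)) (\prod_(i <- r) y i).
Proof.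
move=> F0 FS Fy; elim: r => [|i r IHr] /=.
  by rewrite big_nil; apply: supp_basis; rewrite cards0.
by rewrite big_cons; apply: suppM IHr => //; apply: FS.
Qed.

Lemma lrm_supp (F : nat -> pred nat) P Q (f : {lrmorphism E -> E}) (a : E) :
  F 0 0 -> (forall m i j, F 1 i -> F m j -> F m.+1 (i + j)%N) ->
  (forall i, supp (F 1) (f (X i))) ->
  (forall m d, P m -> F m d -> Q d) -> supp P a -> supp Q (f a).
Proof.
move=> F0 FS Ff PQ Pa; rewrite (ext_sum a) linear_sum.
apply: supp_sum => S _; rewrite linearZ /=.
have [->|/Pa PS] := eqVneq (a S) 0; first by rewrite scale0r; apply: supp0.
apply/suppZ/(supp_sub (fun d => PQ _ d PS)).
by rewrite lrm_basis -prod_enum cardE; apply: supp_prod.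
Qed.

Lemma lrm_par c (f : {lrmorphism E -> E}) (a : E) :
  (forall i, par true (f (X i))) -> par c a -> par c (f a).
Proof.
move=> pf; apply: (@lrm_supp (fun m d => odd d == odd m)) => //= [m i j|m d].
  by rewrite oddD => /eqP-> /eqP->.
by move=> /eqP-> .
Qed.

Lemma coefM0 (a b : E) : (a * b) set0 = a set0 * b set0.
Proof.
rewrite coefM (bigD1 set0) //= (bigD1 set0) //= !big1 ?addr0; first last.
- move=> B /negPf nB; rewrite set0U eq_sym nB mulr0 //.
- move=> A /negPf nA; rewrite big1 // => B _.
  by rewrite eq_sym setU_eq0 nA mulr0.
by rewrite gsign0l setU0 eqxx !mulr1.
Qed.

Lemma supp_ge1 (a : E) : supp (leq 1) a <-> a set0 = 0.
Proof.
split=> [sa|a0 S]; first by apply/eqP/negP => /negP/sa; rewrite cards0.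
by rewrite card_gt0; apply: contraNneq => ->; rewrite a0.
Qed.

Lemma supp_ge2 (a : E) :
  supp (leq 2) a <-> a set0 = 0 /\ forall i, a [set i] = 0.
Proof.
split=> [sa|[a0 a1] S aS].
  split; first by apply/eqP/negP => /negP/sa; rewrite cards0.
  by move=> i; apply/eqP/negP => /negP/sa; rewrite cards1.
case cS: #|S| => [|[|//]].
  by move/eqP: cS; rewrite cards_eq0 => /eqP S0; rewrite S0 a0 eqxx in aS.
by move/eqP/cards1P: cS => [i Si]; rewrite Si a1 eqxx in aS.
Qed.

(** Taking constant terms is multiplicative, so the constant term of the image of a generator
    squares to 0 in the field [K]. *)
Lemma lrm_gen_ge1 (f : {lrmorphism E -> E}) i : supp (leq 1) (f (X i)).
Proof.
apply/supp_ge1/eqP; rewrite -[_ == 0]orbb -mulf_eq0 -coefM0 -rmorphM.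
by have [-> _] := ext_grassmann_rel K n; rewrite rmorph0 ffunE.
Qed.

Lemma lrm_ge d (f : {lrmorphism E -> E}) (a : E) :
  supp (leq d) a -> supp (leq d) (f a).
Proof.
apply: (@lrm_supp leq) => // [m i j|i|m e]; [exact: leq_add| |exact: leq_trans].
exact: lrm_gen_ge1.
Qed.

Lemma linear_part (a : E) : a set0 = 0 ->
  supp (leq 2) (a - \sum_i a [set i] *: X i).
Proof.
move=> a0; apply/supp_ge2; split=> [|j].
  rewrite !ffunE a0 sum_ffunE big1 ?subrr // => i _.
  by rewrite coefZ ffunE eq_sym -cards_eq0 cards1 mulr0.
rewrite !ffunE sum_ffunE (bigD1 j) //= big1 => [|i neij].
  by rewrite coefZ coef_gen eqxx mulr1 addr0 subrr.
by rewrite coefZ coef_gen eq_sym (negPf neij) mulr0.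
Qed.

(** Endomorphisms preserve the elements of order at least 2, so only the linear part of [a]
    contributes. *)
Lemma lrm_coef1 (f : {lrmorphism E -> E}) (a : E) j : a set0 = 0 ->
  f a [set j] = \sum_i a [set i] * f (X i) [set j].
Proof.
move=> /linear_part/(lrm_ge (f := f))/supp_ge2[_ /(_ j)] /eqP.
rewrite linearB linear_sum !ffunE subr_eq0 => /eqP->.
by rewrite sum_ffunE; apply: eq_bigr => i _; rewrite linearZ coefZ.
Qed.

(* The ideal spanned by the top monomial is the socle. *)
Lemma top_in_ideal (a : E) : a != 0 -> exists b, b * a = e_ setT.
Proof.
move=> a0; have [S0 aS0] : exists S, a S != 0.
  apply/existsP; apply: contraNT a0 => /existsPn a0; apply/eqP/ffunP => S.
  by rewrite [RHS]ffunE; apply/eqP/negbNE/a0.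
case: (arg_minnP (P := fun S => a S != 0) (fun S => #|S|) aS0) => S aS minS.
have g0 : gsign K (~: S) S != 0 by rewrite gsign_neq0 disjoints_subset.
(* With [S] of least size in the support, multiplying by the complementary monomial kills every
   monomial not contained in [S], hence all but that of [S]. *)
exists ((gsign K (~: S) S * a S)^-1 *: e_ (~: S)).
apply/ffunP => T; rewrite -scalerAl coefZ coefM_basisl ffunE.
have [->|neT] := eqVneq T setT.
  by rewrite subsetT setTD setCK mulVf // mulf_neq0.
case: ifP => [sST|]; last by rewrite mulr0.
rewrite setDE setCK.
case: (eqVneq (a (T :&: S)) 0) => [->|/minS]; first by rewrite !mulr0.
rewrite leqNgt => /negP[]; apply: proper_card; rewrite properEneq subsetIr andbT.
apply: contraNneq neT => /setIidPr sT; rewrite -subTset -(setUCr S).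
by rewrite subUset sT.
Qed.

(** * Construction of automorphisms *)

(** A nonzero kernel would contain the top monomial, since every nonzero element has it as a
    multiple; injectivity suffices in finite dimension. *)
Lemma lrm_bij (f : {lrmorphism E -> E}) : f (e_ setT) != 0 -> bijective f.
Proof.
(* [g] is [f] with its source retyped as a function space, where the finite-dimensional structure is
   found. *)
move=> ft; pose g : {linear {ffun {set 'I_n} -> K^o} -> _} := f.
apply: (@linear_inj_bij _ _ g); apply: raddf_inj => a fa0.
apply: contraNeq ft => /top_in_ideal[b <-].
by rewrite rmorphM /= [f a]fa0 mulr0.
Qed.

Lemma lrm_basis_id (f : {lrmorphism E -> E}) k A :
  (forall i, i != k -> f (X i) = X i) -> k \notin A -> f (e_ A) = e_ A.
Proof.
move=> fX kA; rewrite lrm_basis ext_basis_prod; apply: eq_bigr => i iA.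
by apply: fX; apply: contraNneq kA => <-.
Qed.

(** Up to sign, the top monomial is the product of [e_ (~: [set k])] and [X k]. In the product of
    [e_ (~: [set k])] and [u], the top coefficient is plus or minus [u [set k]], so the image of the
    top monomial is nonzero and [lrm_bij] applies. *)
Lemma elem_aut k (u : E) : par true u -> u [set k] != 0 ->
  exists f : {lrmorphism E -> E},
    [/\ bijective f, f (X k) = u & forall i, i != k -> f (X i) = X i].
Proof.
move=> pu uk; pose y i := if i == k then u else X i.
have py i : par true (y i) by rewrite /y; case: ifP => // _; apply: par_gen.
pose f : {lrmorphism E -> E} := ext_lift (odd_rel py).
have fk : f (X k) = u by rewrite [LHS]ext_lift_gen /y eqxx.
have fX i : i != k -> f (X i) = X i.
  by move=> neik; rewrite [LHS]ext_lift_gen /y (negPf neik).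
exists f; split=> //; apply: lrm_bij; apply/eqP => f0.
have : f (e_ (~: [set k]) * X k) [set: 'I_n] = 0.
  by rewrite ext_basisM setUC setUCr linearZ /= f0 scaler0 ffunE.
rewrite rmorphM /= (lrm_basis_id (f := f) (k := k)) // ?fk; last by rewrite !inE eqxx.
rewrite coefM_basisl subsetT setTD setCK => /eqP.
rewrite mulf_eq0 (negPf uk) orbF; apply/negP.
by rewrite gsign_neq0 disjoints_subset.
Qed.

(** This brings a nonzero linear coefficient to a prescribed index. *)
Lemma swap_aut k l : exists f : {lrmorphism E -> E},
  involutive f /\ forall a : E, a set0 = 0 -> f a [set k] = a [set l].
Proof.
pose y i := X (tperm k l i).
have py i : par true (y i) by apply: par_gen.
pose f : {lrmorphism E -> E} := ext_lift (odd_rel py).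
have fX i : f (X i) = X (tperm k l i) by rewrite [LHS]ext_lift_gen.
exists f; split=> [a|a a0].
  have /= := @eq_lrm E (f \o f) idfun _ a; apply=> i.
  by rewrite /= !fX tpermK.
rewrite lrm_coef1 // (bigD1 l) //= big1 ?addr0.
  by rewrite fX tpermR coef_gen eqxx mulr1.
move=> i neil; rewrite fX coef_gen -{1}(tpermR k l) (inj_eq perm_inj).
by rewrite eq_sym (negPf neil) mulr0.
Qed.

(** * Normality of the two orbit representatives *)

(** Moving [a] past a basis element costs a nonzero scalar, which the coefficients of the cofactor
    absorb. *)
Lemma normal_twist (a : E) (t : {set 'I_n} -> K) : (forall S, t S != 0) ->
  (forall S, a * e_ S = t S *: (e_ S * a)) -> normal_elt a.
Proof.
move=> t0 aS z; split=> -[b ->]; rewrite (ext_sum b).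
  exists (\sum_S (t S * b S) *: e_ S); rewrite mulr_sumr mulr_suml.
  apply: eq_bigr => S _; rewrite -scalerAr -scalerAl aS scalerA.
  by rewrite [b S * _]mulrC.
exists (\sum_S ((t S)^-1 * b S) *: e_ S); rewrite mulr_sumr mulr_suml.
apply: eq_bigr => S _; rewrite -scalerAr -scalerAl aS scalerA.
by rewrite mulrAC mulVf // mul1r.
Qed.

Lemma normal_gen k : normal_elt (X k).
Proof.
apply: (@normal_twist _ (fun S => (-1) ^+ (#|[set k]| * #|S|))) => S.
  by rewrite signr_eq0.
exact: basisC.
Qed.

Lemma par_cosingle k : odd n -> par false (e_ (~: [set k])).
Proof.
move=> on; apply: supp_basis.
by rewrite cardsC1 card_ord -subn1 oddB ?on // odd_gt0.
Qed.

Lemma cosingle_mul_basis k S : ~~ (S \subset [set k]) ->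
  e_ (~: [set k]) * e_ S = 0.
Proof.
move=> nsS; rewrite ext_basisM gsign_meet ?scale0r //.
by rewrite disjoint_sym disjoints_subset setCK.
Qed.

(** The monomial [e_ (~: [set k])] is even and annihilates [e_ S] unless [S] is contained in
    [[set k]]. So the sum commutes with 1 and [X k], and follows the sign rule of [X k] on all other
    basis elements. *)
Lemma normal_gen_cosingle k : odd n -> normal_elt (X k + e_ (~: [set k])).
Proof.
move=> on; apply: (@normal_twist _
  (fun S => if S \subset [set k] then 1 else (-1) ^+ #|S|)) => S.
  by case: ifP; rewrite ?signr_eq0 ?oner_eq0.
rewrite mulrDl mulrDr; have ec := even_comm (e_ S) (@par_cosingle k on).
case: ifPn => [|nsS].
  rewrite scale1r -ec subset1 => /orP[] /eqP->.
    by [].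
  by rewrite -[e_ set0]/(1 : E) mulr1 mul1r.
by rewrite -ec cosingle_mul_basis // !addr0 basisC cards1 mul1n.
Qed.

(** * The set [N1] in terms of coefficients *)

(** This is [N1] without the grading, which automorphisms need not respect; [N1E] gives the
    equivalence. *)
Definition linear_normal (a : E) : Prop :=
  [/\ normal_elt a, a set0 = 0 & exists k, a [set k] != 0].

(* An automorphism cannot push [a] into the square of the augmentation ideal:
   multiplied by a monomial of degree [n - 1] it would vanish. *)
Lemma linear_normal_aut (f : {lrmorphism E -> E}) (a : E) :
  bijective f -> linear_normal a -> linear_normal (f a).
Proof.
move=> bf [na a0 [k ak]]; split; first exact/(normal_bij a bf).
  by apply/supp_ge1/lrm_ge/supp_ge1.
apply/existsP; apply: contraNT ak => /existsPn fa1.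
have fa2 : supp (leq 2) (f a).
  apply/supp_ge2; split=> [|i]; first exact/supp_ge1/lrm_ge/supp_ge1.
  exact/eqP/negbNE/fa1.
have : f (e_ (~: [set k]) * a) = 0.
  have n0 : (0 < n)%N by case: (k) => i; case: n.
  have : supp (leq n.+1) (f (e_ (~: [set k]) * a)).
    rewrite rmorphM; apply: (suppM (P := leq n.-1)) fa2 => [i j|].
      by move=> lei lej; rewrite -(prednK n0) -addn2 leq_add.
    by apply/lrm_ge/supp_basis; rewrite cardsC1 card_ord.
  move=> sf; apply/ffunP => S; rewrite [RHS]ffunE; apply/eqP/negP => /negP/sf /=.
  by rewrite ltnNge -[X in (_ <= X)%N](card_ord n) max_card.
rewrite -(rmorph0 f) => /(bij_inj bf)/ffunP/(_ setT)/eqP.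
rewrite coefM_basisl subsetT setTD setCK ffunE mulf_eq0.
by rewrite (negPf (_ : gsign K _ _ != 0)) // gsign_neq0 disjoints_subset.
Qed.

Lemma homogE d (a : E) : homog X d a <-> supp (pred1 d) a.
Proof.
split=> [[c ->]|sa].
  apply: supp_sum => s _; apply: suppZ; rewrite -[X in pred1 X](size_tuple s).
  apply: (@supp_prod (fun m => pred1 m)) => //= [m i j|i].
    by move=> /eqP-> /eqP->.
  by apply: supp_basis; rewrite /= cards1.
suff hS S : #|S| = d -> homog X d (e_ S).
  rewrite (ext_sum a); elim/big_rec: _ => [|S b _ [c ->]].
    by exists (fun=> 0); rewrite big1 // => s _; rewrite scale0r.
  have [->|/sa/eqP/hS[c' ->]] := eqVneq (a S) 0.
    by exists c; rewrite scale0r add0r.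
  exists (fun s => a S * c' s + c s); rewrite scaler_sumr -big_split.
  by apply: eq_bigr => s _; rewrite scalerA scalerDl.
(* Among all orderings of [S], only the increasing one receives a nonzero coefficient. *)
move=> cS; have sS : size (enum S) == d by rewrite -cardE cS.
exists (fun s => (s == Tuple sS)%:R).
rewrite (bigD1 (Tuple sS)) /= ?enum_uniq // eqxx scale1r.
rewrite prod_enum -ext_basis_prod big1 ?addr0 // => s /andP[_ /negPf->].
by rewrite scale0r.
Qed.

Lemma N1E (a : E) : (0 < n)%N -> N1 X a <-> linear_normal a.
Proof.
move=> n0; split=> [[na [a_ [ha a1 aE]]]|[na a0 [k ak]]].
  split=> //.
    rewrite aE; apply/supp_ge1; rewrite big_seq_cond; apply: supp_sum => i.
    rewrite mem_index_iota andbT => li; apply: (supp_sub (P := pred1 i)).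
      by move=> d /eqP->; case/andP: li.
    by apply/homogE/ha.
  have [S a1S] : exists S, a_ 1%N S != 0.
    apply/existsP; apply: contraNT a1 => /existsPn a1; apply/eqP/ffunP => S.
    by rewrite [RHS]ffunE; apply/eqP/negbNE/a1.
  have /homogE/(_ S a1S) : homog X 1 (a_ 1%N) by apply: ha; rewrite n0.
  move=> /cards1P[k Sk]; exists k; rewrite -Sk aE big_ltn // ffunE sum_ffunE.
  rewrite big_nat big1 ?addr0 // => i /andP[i1 i2].
  have /homogE hi : homog X i (a_ i) by apply: ha; rewrite (ltnW i1).
  apply/eqP/negP => /negP/hi; rewrite Sk cards1 /= => /eqP i1E.
  by rewrite -i1E in i1.
split=> //.
exists (fun d => [ffun S : {set 'I_n} => if #|S| == d then a S else 0]).
split=> [i _||].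
- by apply/homogE => S; rewrite ffunE /=; case: ifP => //; rewrite eqxx.
- by apply: contraNneq ak => /ffunP/(_ [set k]); rewrite !ffunE cards1 eqxx => ->.
apply/ffunP => S; rewrite sum_ffunE.
have [S0|S0] := posnP #|S|.
  rewrite big_nat big1 => [|i /andP[i0 _]]; last first.
    by rewrite ffunE S0; case: i i0.
  by move/eqP: S0; rewrite cards_eq0 => /eqP->.
rewrite (bigD1_seq #|S|) ?iota_uniq //=; last first.
  by rewrite mem_index_iota S0 ltnS -[X in (_ <= X)%N](card_ord n) max_card.
rewrite ffunE eqxx big1 ?addr0 // => i; rewrite ffunE eq_sym => /negPf->.
by [].
Qed.

(** * Normal elements whose even tail is free of [X k] *)

(** Let [T] be a monomial of least degree in [q]. If [T] missed an index [i] other than [k], the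
    left side of [key] would have a nonzero coefficient in degree [#|T| + 2], while the right side
    starts in degree [2 * #|T| + 1]; this contradicts [2 <= #|T|]. *)
Lemma normal_reduced k (q : E) : normal_elt (X k + q) ->
  (forall S, k \in S -> q S = 0) -> par false q -> supp (leq 2) q ->
  q = q (~: [set k]) *: e_ (~: [set k]).
Proof.
move=> na qk pq q2; suff qS S : q S != 0 -> S = ~: [set k].
  apply/ffunP => S; rewrite coefZ ffunE.
  case: (eqVneq S (~: [set k])) => [->|neS]; first by rewrite mulr1.
  by rewrite mulr0; apply/eqP; apply: contraNT neS => /qS->.
move=> qS; case: (arg_minnP (P := fun T => q T != 0) (fun T => #|T|) qS).
move=> T qT minT; have kq U : q U != 0 -> U \subset ~: [set k].
  by move=> qU; rewrite subsetC sub1set inE; apply: contraNN qU => /qk->.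
(* Every [S] in the support lies in the complement of [k] and is at least as large as [T]. *)
suff TE : T = ~: [set k].
  by apply/eqP; rewrite eqEcard kq // -TE minT.
apply/eqP; rewrite eqEsubset kq //=; apply/subsetP => i; rewrite !inE => neik.
apply: contraTT isT => iT.
have [b hb] : exists b, X i * (X k + q) = (X k + q) * b.
  by apply/na; exists (X i).
have qC u : q * u = u * q by apply: even_comm.
have XX : X k * X k = 0 by have [->] := ext_grassmann_rel K n.
have YX : X i * X k = - (X k * X i).
  by have [_ ->] := ext_grassmann_rel K n.
(* Multiply [hb] on the left by [X k - q], as
   [(X k - q) * (X k + q) = - (q * q)]. *)
have key : 2%:R *: (X k * (X i * q)) = (q * q) * (X i - b).
  have sq : (X k - q) * (X k + q) = - (q * q).
    by rewrite mulrDr !mulrBl XX qC sub0r addrA addNr sub0r.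
  have : (X k - q) * (X i * (X k + q)) = - (q * q) * b by rewrite hb mulrA sq.
  have h1 : X k * (X i * X k) = 0 by rewrite YX mulrN mulrA XX mul0r oppr0.
  have h2 : q * (X i * X k) = - (X k * (X i * q)).
    by rewrite YX mulrN qC -mulrA.
  have h3 : q * (X i * q) = q * q * X i by rewrite -qC mulrA.
  rewrite !mulrDr !mulrBl h1 h2 h3 sub0r opprK mulrN mulNr => <-.
  by rewrite scaler_nat mulr2n addrCA (addrCA (q * q * X i)) subrr addr0.
(* Compare the coefficients of [X k] in [hb]: the left side is a multiple of [X i] and has none, and
   [q * b] has order at least 2. Hence [X i - b] has order at least 1; this extra degree is what
   excludes [#|T| = 2]. *)
have b0 : b set0 = 0.
  have : (X i * (X k + q)) [set k] = ((X k + q) * b) [set k] by rewrite hb.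
  rewrite coefM_basisl sub1set inE (negPf neik) mulrDl ffunE coefM_basisl.
  rewrite subxx setDv gsign0r mul1r.
  suff /supp_ge2[_ ->] : supp (leq 2) (q * b) by rewrite addr0 => <-.
  apply: (suppM (Q := predT)) q2 _ => // x y x2 _.
  exact: leq_trans (leq_addr _ _).
have bY : supp (leq 1) (X i - b).
  apply: suppD; last by apply/suppN/supp_ge1.
  by apply/supp_basis; rewrite cards1.
have sq : supp (leq #|T|) q by move=> U /minT.
have : supp (leq (#|T| + #|T| + 1)) (2%:R *: (X k * (X i * q))).
  rewrite key; apply: suppM (suppM _ sq sq) bY => x y; exact: leq_add.
have kT : k \notin T by apply: contraNN qT => /qk->.
have kiT : k \notin i |: T by rewrite !inE eq_sym (negPf neik).
move=> /(_ (k |: (i |: T))).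
rewrite !coefZ !coefM_basisl subsetUl setU1K // subsetUl setU1K //.
rewrite !mulf_eq0 !negb_or two_neq0 !gsign_neq0 qT !disjoints1 kiT iT.
rewrite !cardsU1 kiT iT /= => /(_ isT).
have /q2 /= := qT; lia.
Qed.

(** * Reduction of a normal element to one of the two representatives *)

Lemma aut_orbit_trans (L : algType K) (a b c : L) :
  aut_orbit a b -> aut_orbit b c -> aut_orbit a c.
Proof.
move=> [f [bf ->]] [g [bg ->]]; exists (g \o f).
by split=> //; apply: bij_comp.
Qed.

Lemma scale_cosingle k l c : l != k -> c != 0 ->
  aut_orbit (X k + e_ (~: [set k])) (X k + c *: e_ (~: [set k])).
Proof.
move=> nelk c0; have pc : par true (c *: X l) by apply/suppZ/par_gen.
have cl : (c *: X l) [set l] != 0 by rewrite coefZ coef_gen eqxx mulr1.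
have [f [bf fl fX]] := elem_aut pc cl.
exists f; split=> //; rewrite rmorphD /= fX 1?eq_sym //; congr (_ + _).
(* Splitting [X l] off the monomial costs a sign [g], which is nonzero and is cancelled from both
   sides. *)
pose B := ~: [set k] :\ l; pose g := gsign K [set l] B.
have g0 : g != 0 by rewrite gsign_neq0 disjoints1 !inE eqxx.
have lB : X l * e_ B = g *: e_ (~: [set k]).
  by rewrite ext_basisM setD1K // !inE.
apply: (scalerI g0); rewrite -[RHS]linearZ /= -lB rmorphM /= fl.
rewrite (lrm_basis_id (f := f) (k := l)) // ?inE ?eqxx //.
by rewrite -scalerAl lB !scalerA mulrC.
Qed.

(* The part of [e] divisible by [X k] is removed by an inner automorphism. *)
Lemma orbit_even_tail k l (e : E) : l != k ->
  normal_elt (X k + e) -> par false e -> supp (leq 2) e ->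
  aut_orbit (X k) (X k + e) \/
  odd n /\ aut_orbit (X k + e_ (~: [set k])) (X k + e).
Proof.
move=> nelk na pe e2.
(* Dividing by the sign makes [X k * p] reproduce exactly the monomials of [e] that contain [k]. *)
pose p : E := [ffun S : {set 'I_n} => if k \in S then 0 else
  (gsign K [set k] S)^-1 * e (k |: S)].
pose q : E := [ffun S : {set 'I_n} => if k \in S then 0 else e S].
have eE : e = X k * p + q.
  apply/ffunP => S; rewrite ffunE coefM_basisl sub1set !ffunE !inE eqxx /=.
  case: ifP => kS; last by rewrite add0r.
  rewrite setD1K // addr0 mulrA mulfV ?mul1r // gsign_neq0 disjoints1.
  by rewrite !inE eqxx.
have pp : par true p.
  move=> S; rewrite ffunE; case: ifPn => [|kS]; first by rewrite eqxx.
  by rewrite mulf_eq0 => /norP[_ /pe]; rewrite cardsU1 kS /=; case: odd.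
have supq P : supp P e -> supp P q.
  by move=> Pe S; rewrite ffunE; case: ifP => [|_ /Pe //]; rewrite eqxx.
(* As [X k] anticommutes with [v], conjugation by [1 + v] multiplies [X k] on the right by the
   square of [1 - v], that is [1 - 2 v]; the factor minus one half turns this into [1 + p]. *)
pose v : E := - 2%:R^-1 *: p; have pv : par true v by apply: suppZ.
have vv : v * v = 0 by apply: odd_sq0.
have uvK : (1 + v) * (1 - v) = 1.
  by rewrite mulrDl !mulrBr vv !mulr1 mul1r subr0 subrK.
have vuK : (1 - v) * (1 + v) = 1.
  by rewrite mulrDr !mulrBl vv !mulr1 mul1r subr0 subrK.
pose f : {lrmorphism E -> E} := conj_by uvK vuK.
have bf : bijective f by apply: conj_by_bij.
have fq : f q = q.
  by rewrite /f /= /conj_by -mulrA (even_comm _ (supq _ pe)) mulrA uvK mul1r.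
have fX : f (X k) = X k + X k * p.
  have uX : (1 + v) * X k = X k * (1 - v).
    by rewrite mulrDl mulrBr mul1r mulr1 (odd_anticomm pv (@par_gen k)).
  have vp : v + v = - p.
    by rewrite -mulr2n -scaler_nat scalerA mulrN mulfV // scaleN1r.
  have sq : (1 - v) * (1 - v) = 1 + p.
    by rewrite mulrBl !mulrBr !mul1r mulr1 vv subr0 -addrA -opprD vp opprK.
  by rewrite /f /= /conj_by uX -mulrA sq mulrDr mulr1.
clearbody f.
have fXq : f (X k + q) = X k + e by rewrite rmorphD /= fX fq eE addrA.
have nq : normal_elt (X k + q) by apply/(normal_bij _ bf); rewrite /= fXq.
have qk S : k \in S -> q S = 0 by rewrite ffunE => ->.
have qE := normal_reduced nq qk (supq _ pe) (supq _ e2).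
have [c0|c0] := eqVneq (q (~: [set k])) 0.
  by left; exists f; rewrite -fXq qE c0 scale0r addr0.
(* The even element [q] has a nonzero coefficient in degree [n - 1], so [n] is odd. *)
right; split.
  have /supq/(_ _ c0)/= := pe; rewrite cardsC1 card_ord -(ltn_predK (ltn_ord k)).
  by rewrite /=; case: odd.
apply: aut_orbit_trans (scale_cosingle nelk c0) _; rewrite -qE.
by exists f.
Qed.

Lemma par_both0 (u : E) : par true u -> par false u -> u = 0.
Proof.
move=> pt pf; apply/ffunP => S; rewrite [RHS]ffunE; apply/eqP/negP => /negP uS.
by have := pt _ uS; have := pf _ uS => /eqP->.
Qed.

Lemma orbit_coef1 k l (a : E) : l != k ->
  normal_elt a -> a set0 = 0 -> a [set k] != 0 ->
  aut_orbit (X k) a \/ odd n /\ aut_orbit (X k + e_ (~: [set k])) a.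
Proof.
move=> nelk na a0 ak.
have aok : part true a [set k] != 0 by rewrite ffunE cards1 eqxx.
have [f [bf fk fX]] := elem_aut (@par_part true a) aok.
have fpar c u : par c u -> par c (f u).
  apply: lrm_par => i; have [->|/fX->] := eqVneq i k; last exact: par_gen.
  by rewrite fk; apply: par_part.
have [g fK gK] := bf; pose e := g a - X k.
have fe : f e = part false a.
  by rewrite rmorphB /= gK fk {1}(part_sum a) addrC addKr.
(* [f] preserves parity, so the image of the odd part of [e] is odd; it is also even, as the
   difference of [f e] and the image of the even part. *)
have eo : part true e = 0.
  apply: (bij_inj bf); rewrite rmorph0; apply: par_both0.
    exact/fpar/par_part.
  have -> : f (part true e) = f e - f (part false e).
    by rewrite {2}(part_sum e) rmorphD addrK.
  rewrite fe; apply: suppD; first exact: par_part.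
  exact/suppN/fpar/par_part.
have pe : par false e by rewrite (part_sum e) eo add0r; apply: par_part.
have aE : a = f (X k + e) by rewrite addrC subrK gK.
have e2 : supp (leq 2) e.
  apply/supp_ge2; split=> [|i]; last first.
    by apply/eqP/negP => /negP/pe; rewrite cards1.
  (* Subtracting the constant term of [e] leaves an element whose image has none; since [f] fixes
     constants and [f e] has constant term 0, that of [e] is 0. *)
  have : supp (leq 1) (f (e - e set0 *: 1)).
    apply/lrm_ge/supp_ge1; rewrite !ffunE eqxx /GRing.scale /= mulr1.
    by rewrite subrr.
  rewrite linearB linearZ /= rmorph1 fe => /supp_ge1.
  rewrite !ffunE cards0 eqxx a0 sub0r /GRing.scale /= mulr1 => /eqP.
  by rewrite oppr_eq0 => /eqP.
have ne : normal_elt (X k + e) by apply/(normal_bij _ bf); rewrite /= -aE.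
have fo : aut_orbit (X k + e) a by exists f.
have [h|[on h]] := orbit_even_tail nelk ne pe e2; [left|right; split=> //];
  exact: aut_orbit_trans h fo.
Qed.

Lemma linear_normal_orbit k l (a : E) : l != k -> linear_normal a ->
  aut_orbit (X k) a \/ odd n /\ aut_orbit (X k + e_ (~: [set k])) a.
Proof.
move=> nelk [na a0 [j aj]]; have [s [sK s1]] := swap_aut k j.
have bs : bijective s by apply: inv_bij.
have so : aut_orbit (s a) a by exists s; rewrite sK.
have [|||h|[on h]] := @orbit_coef1 k l (s a) nelk.
- exact/(normal_bij a bs).
- by apply/supp_ge1/lrm_ge/supp_ge1.
- by rewrite s1.
- by left; apply: aut_orbit_trans h so.
- by right; split=> //; apply: aut_orbit_trans h so.
Qed.

Lemma orbit_linear_normal (a b : E) :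
  linear_normal a -> aut_orbit a b -> linear_normal b.
Proof. by move=> na [f [bf ->]]; apply: linear_normal_aut. Qed.

(** * The two representatives and the disjointness of their orbits *)

Lemma linear_normal_gen k : linear_normal (X k).
Proof.
split; first exact: normal_gen.
  by apply/supp_ge1/supp_basis; rewrite cards1.
by exists k; rewrite coef_gen eqxx oner_eq0.
Qed.

Lemma linear_normal_gen_cosingle k l : l != k -> odd n ->
  linear_normal (X k + e_ (~: [set k])).
Proof.
move=> nelk on; have lk : l \in ~: [set k] by rewrite !inE.
split; first exact: normal_gen_cosingle.
  apply/supp_ge1/suppD; apply: supp_basis; first by rewrite cards1.
  by rewrite card_gt0; apply/set0Pn; exists l.
exists k; rewrite ffunE coef_gen eqxx ffunE.
case: (eqVneq [set k] (~: [set k])) => [kE|_]; last by rewrite addr0 oner_eq0.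
by have := set11 k; rewrite kE !inE eqxx.
Qed.

(** Both cross terms agree because the monomial is even, and they add up to twice the top monomial
    up to sign. The index [l] makes the monomial nonconstant, so that its own square vanishes. *)
Lemma gen_cosingle_sq k l : l != k -> odd n ->
  (X k + e_ (~: [set k])) * (X k + e_ (~: [set k])) != 0.
Proof.
move=> nelk on; have lk : l \in ~: [set k] by rewrite !inE.
rewrite mulrDl !mulrDr odd_sq0 ?add0r; last exact: par_gen.
rewrite (even_comm (X k) (@par_cosingle k on)).
rewrite !ext_basisM setUCr (gsign_meet K (A := ~: _)); last first.
  by apply/negP => /disjointFr/(_ lk); rewrite lk.
rewrite scale0r addr0 -mulr2n -scaler_nat !scaler_eq0 !negb_or two_neq0 /=.
rewrite gsign_neq0 disjoints1 !inE eqxx /=; apply/eqP => /ffunP/(_ setT)/eqP.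
by rewrite !ffunE eqxx oner_eq0.
Qed.

Lemma orbits_disjoint k l (a : E) : l != k -> odd n ->
  ~ (aut_orbit (X k) a /\ aut_orbit (X k + e_ (~: [set k])) a).
Proof.
move=> nelk on [[f [_ ->]] [g [bg gE]]].
have /negP[] := gen_cosingle_sq nelk on; apply/eqP/(bij_inj bg).
by rewrite rmorph0 rmorphM /= -gE -rmorphM odd_sq0 ?rmorph0 //; apply: par_gen.
Qed.

End Exterior.

(** * Transfer between the model and an arbitrary Grassmann algebra *)

(** This is the uniqueness of initial objects: both composites fix the generators, hence are
    identities. *)
Lemma grassmann_model (K : fieldType) (n : nat) (L : algType K)
    (x : 'I_n -> L) : is_grassmann x ->
  exists (h : {lrmorphism L -> ext K n}) (g : {lrmorphism ext K n -> L}),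
    [/\ cancel h g, cancel g h, forall i, h (x i) = ext_gen K i
      & forall i, g (ext_gen K i) = x i].
Proof.
move=> [x_rel xU]; have [h [hx _]] := xU _ _ (ext_grassmann_rel K n).
pose g : {lrmorphism ext K n -> L} := ext_lift x_rel.
have gX i : g (ext_gen K i) = x i by rewrite [LHS]ext_lift_gen.
exists h, g; split=> // [a|a].
  have [f [_ fU]] := xU _ _ x_rel.
  have /= -> := fU (g \o h) _ a; last by move=> i; rewrite /= hx gX.
  by rewrite -(fU idfun).
by have /= := @eq_lrm K n _ (h \o g) idfun _ a; apply=> i; rewrite /= gX.
Qed.

Section Transfer.

Variables (K : fieldType) (n : nat) (L M : algType K).
Variables (x : 'I_n -> L) (y : 'I_n -> M) (h : {lrmorphism L -> M}).

Lemma homog_lrm d (a : L) : (forall i, h (x i) = y i) ->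
  homog x d a -> homog y d (h a).
Proof.
move=> hx [c ->]; exists c; rewrite linear_sum; apply: eq_bigr => s _.
by rewrite linearZ /= rmorph_prod; congr (_ *: _); apply: eq_bigr => i _; apply: hx.
Qed.

Lemma N1_lrm (a : L) : (forall i, h (x i) = y i) -> bijective h ->
  N1 x a -> N1 y (h a).
Proof.
move=> hx bh [na [a_ [ha a1 aE]]]; split; first exact/(normal_bij a bh).
exists (h \o a_); split=> [i /ha|| /=]; first exact: homog_lrm.
  by rewrite /= -(rmorph0 h) (inj_eq (bij_inj bh)).
by rewrite aE rmorph_sum.
Qed.

Lemma aut_orbit_lrm (g : {lrmorphism M -> L}) (a b : L) :
  cancel h g -> cancel g h -> aut_orbit a b -> aut_orbit (h a) (h b).
Proof.
move=> hK gK [f [bf ->]]; exists (h \o f \o g); split=> /=; last by rewrite hK.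
by apply: bij_comp; [apply: bij_comp => //; exists g | exists h].
Qed.

End Transfer.

Unset Implicit Arguments.

Theorem theorem4p3 (K : fieldType) (n : nat) (L : algType K) (x : 'I_n -> L)
    (hK : 2%N \notin [pchar K]) (hn : (2 <= n)%N) (hL : is_grassmann x) :
  let x1 := x (Ordinal (ltnW hn)) in
  let w := x1 + \prod_(i < n | (0 < i)%N) x i in
  (~~ odd n -> forall a : L, N1 x a <-> aut_orbit x1 a) /\
  (odd n ->
    (forall a : L, N1 x a <-> aut_orbit x1 a \/ aut_orbit w a) /\
    (forall a : L, ~ (aut_orbit x1 a /\ aut_orbit w a))).
Proof.
move=> x1 w; have two_neq0 : 2%:R != 0 :> K.
  by apply: contraNN hK => /eqP two0; rewrite inE /= two0 eqxx.
(* [k] has value 0 and [l] has value 1: they index the first two generators, and [l] is the second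
   index required by the orbit lemmas. *)
pose k := Ordinal (ltnW hn); pose l := Ordinal hn.
have nelk : l != k by [].
have [h [g [hgK ghK hx gX]]] := grassmann_model hL.
pose w' := ext_gen K k + ext_basis K (~: [set k]).
have hx1 : h x1 = ext_gen K k by apply: hx.
have hw : h w = w'.
  rewrite rmorphD rmorph_prod /= hx1 /w' ext_basis_prod; congr (_ + _).
  by apply: eq_big => // i; rewrite !inE -val_eqE lt0n.
have N1h a : N1 x a <-> linear_normal (h a).
  have bh : bijective h by exists g.
  have bg : bijective g by exists h.
  rewrite -N1E ?(ltnW hn) //; split=> [|/(N1_lrm gX bg)]; last by rewrite hgK.
  exact: N1_lrm.
(* Conjugation by the isomorphism [h] identifies the two automorphism groups, so the classification
   in the model carries over to [L]. *)
have orbh a b : aut_orbit a b <-> aut_orbit (h a) (h b).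
  split=> [|/(aut_orbit_lrm ghK hgK)]; last by rewrite !hgK.
  exact: aut_orbit_lrm.
have orb1 a : aut_orbit x1 a -> N1 x a.
  move/orbh; rewrite hx1 => ha; apply/N1h.
  exact: orbit_linear_normal (linear_normal_gen K k) ha.
split=> [/negP en a|on].
  split=> [/N1h/(linear_normal_orbit two_neq0 nelk)[|[//]]|/orb1 //].
  by rewrite -hx1 => /orbh.
split=> a; last first.
  move=> [/orbh + /orbh]; rewrite hx1 hw => a1 aw.
  exact: (orbits_disjoint two_neq0 nelk on (conj a1 aw)).
split=> [/N1h/(linear_normal_orbit two_neq0 nelk)|[/orb1 //|/orbh]].
  case=> [|[_]]; first by rewrite -hx1 => /orbh; left.
  by rewrite -/w' -hw => /orbh; right.
rewrite hw => ha; apply/N1h.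
exact: orbit_linear_normal (linear_normal_gen_cosingle two_neq0 nelk on) ha.
Qed.
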